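(* Suppose the maximum degree $\Delta$ of any vertex of $G$ is at most $m^{1/2-\alpha}$, where $\alpha>0$, and $t\le C\le\min(m^{2\alpha},m^{1/3})$. Then the expected number (over the random coloring) of $2k$-tuples $\vec T=(\vec T_1,\vec T_2)$ of edges of $\vec G$ such that $\vec T_1$ and $\vec T_2$ are both distinctly color-compatible, $\vec T$ satisfies Condition 1 or 3 at every vertex of $H$, and $\vec T$ does not satisfy Condition 1 at every vertex of $H$, is $O(m^k/C^{2k-t})$, with implied constant depending only on $H$.
   Context: $H$ is a fixed connected finite simple graph with no leaves, vertices $1,\dots,t$, $k$ edges, oriented arbitrarily as $\vec H$ with directed edges $\overrightarrow{a_1a_2},\dots,\overrightarrow{a_{2k-1}a_{2k}}$, $a_i\in\{1,\dots,t\}$; $\Gamma(b)=\{i\in\{1,\dots,2k\}:a_i=b\}$. $G$ is a finite simple graph; $\vec G$ replaces each edge $vw$ by $\overrightarrow{vw},\overrightarrow{wv}$; $m$ is the number of edges of $\vec G$. A coloring $\mathcal C:V(G)\to\{1,\dots,C\}$ is chosen uniformly from a $4k$-wise independent family of hash functions, each value uniform. A $k$-tuple $(\overrightarrow{u_1u_2},\dots,\overrightarrow{u_{2k-1}u_{2k}})$ of edges of $\vec G$ is distinctly color-compatible if there are pairwise distinct colors $c_1,\dots,c_t$ with $\mathcal C(u_i)=c_{a_i}$ for all $i$. Write $\vec T_1=(\overrightarrow{v_1v_2},\dots,\overrightarrow{v_{2k-1}v_{2k}})$, $\vec T_2=(\overrightarrow{w_1w_2},\dots,\overrightarrow{w_{2k-1}w_{2k}})$.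 Conditions at a vertex $b$ of $H$: Condition 1: the $v_i$, $i\in\Gamma(b)$, are all equal and the $w_i$, $i\in\Gamma(b)$, are all equal. Condition 3: there are vertices $x,y$ of $G$ such that for every $i\in\Gamma(b)$, either ($v_i=x$, $w_i=y$) or ($v_i=y$, $w_i=x$). *)

(* Defs.v *)
From mathcomp Require Import all_boot all_order all_algebra.
From mathcomp Require Import reals exp.

Set Implicit Arguments.
Unset Strict Implicit.
Unset Printing Implicit Defensive.

Import Order.TTheory GRing.Theory Num.Theory.
Local Open Scope ring_scope.

Definition simple_graph (T : finType) (e : rel T) : Prop :=
  symmetric e /\ irreflexive e.

Definition neighbors (T : finType) (e : rel T) (x : T) : {set T} :=
  [set y | e x y].

Definition degree (T : finType) (e : rel T) (x : T) : nat :=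
  #|neighbors e x|.

Definition max_degree (T : finType) (e : rel T) : nat :=
  (\max_(x : T) degree e x)%N.

Definition connected_graph (T : finType) (e : rel T) : Prop :=
  (0 < #|T|)%N /\ forall x y : T, connect e x y.

Definition no_leaves (T : finType) (e : rel T) : Prop :=
  forall x : T, degree e x <> 1%N.

Definition edge_set (T : finType) (e : rel T) : {set {set T}} :=
  [set [set p.1; p.2] | p : T * T & e p.1 p.2].

(* The directed edges of the graph obtained by replacing each edge xy with
   the two arcs (x, y) and (y, x). *)
Definition arc_set (T : finType) (e : rel T) : {set T * T} :=
  [set p | e p.1 p.2].

(* [a] lists the edges of [e], each exactly once and in one direction. *)
Definition orientation (T : finType) (e : rel T) (k : nat)
    (a : k.-tuple (T * T)) : Prop :=
  perm_eq [seq [set p.1; p.2] | p <- a] (enum (edge_set e)).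

(* A k-tuple of arcs has 2k endpoint positions, indexed by 'I_k * bool: with
   j counted from 0, (j, false) is the tail of arc j (position 2j+1 of
   1, ..., 2k) and (j, true) is its head (position 2j+2). *)
Definition endpoint (T : finType) (k : nat) (a : k.-tuple (T * T))
    (i : 'I_k * bool) : T :=
  if i.2 then (tnth a i.1).2 else (tnth a i.1).1.

Definition Gamma (T : finType) (k : nat) (a : k.-tuple (T * T)) (b : T) :
    {set 'I_k * bool} :=
  [set i | endpoint a i == b].

Definition arc_tuple (V : finType) (e : rel V) (k : nat)
    (u : k.-tuple (V * V)) : bool :=
  all (mem (arc_set e)) u.

Definition distinctly_color_compatible (T V : finType) (C k : nat)
    (a : k.-tuple (T * T)) (col : V -> 'I_C) (u : k.-tuple (V * V)) : bool :=
  [exists c : {ffun T -> 'I_C},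
     injectiveb c && [forall i, col (endpoint u i) == c (endpoint a i)]].

Definition condition1 (T V : finType) (k : nat) (a : k.-tuple (T * T))
    (v w : k.-tuple (V * V)) (b : T) : bool :=
  [forall i in Gamma a b, forall j in Gamma a b,
     (endpoint v i == endpoint v j) && (endpoint w i == endpoint w j)].

Definition condition3 (T V : finType) (k : nat) (a : k.-tuple (T * T))
    (v w : k.-tuple (V * V)) (b : T) : bool :=
  [exists x : V, exists y : V, forall i in Gamma a b,
     ((endpoint v i == x) && (endpoint w i == y))
     || ((endpoint v i == y) && (endpoint w i == x))].

(* The pairs (T1, T2), i.e. the 2k-tuples, counted for a given coloring. *)
Definition counted_tuples (T V : finType) (C k : nat) (e : rel V)
    (a : k.-tuple (T * T)) (col : V -> 'I_C) :
    {set k.-tuple (V * V) * k.-tuple (V * V)} :=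
  [set vw | [&& arc_tuple e vw.1, arc_tuple e vw.2,
                distinctly_color_compatible a col vw.1,
                distinctly_color_compatible a col vw.2,
                [forall b, condition1 a vw.1 vw.2 b
                           || condition3 a vw.1 vw.2 b]
              & ~~ [forall b, condition1 a vw.1 vw.2 b]]].

Definition prob (R : realType) (S : finType) (A : {set S}) : R :=
  #|A|%:R / #|S|%:R.

Definition expectation (R : realType) (S : finType) (X : S -> R) : R :=
  (\sum_(s : S) X s) / #|S|%:R.

(* A hash family is indexed by a nonempty finite type [S] of seeds (so a
   function may occur several times).  The events are required to factor for
   all sets of at most q points, not only exactly q, so that the condition is
   not vacuous when there are fewer than q points. *)
Definition wise_independent (R : realType) (q : nat) (S V : finType) (C : nat)
    (h : S -> V -> 'I_C) : Prop :=
  forall (A : {set V}) (f : V -> 'I_C), (#|A| <= q)%N ->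
    prob R [set s | [forall x in A, h s x == f x]]
    = \prod_(x in A) prob R [set s | h s x == f x].

Definition uniform_values (R : realType) (S V : finType) (C : nat)
    (h : S -> V -> 'I_C) : Prop :=
  forall (x : V) (c : 'I_C), prob R [set s | h s x == c] = C%:R^-1.

(* Main.v *)
Require Import Defs.
From mathcomp Require Import all_boot all_order all_algebra.
From mathcomp Require Import reals exp.
From mathcomp Require Import zify.

Set Implicit Arguments.
Unset Strict Implicit.
Unset Printing Implicit Defensive.

Import Order.TTheory GRing.Theory Num.Theory.
Local Open Scope ring_scope.

(* A counted pair is determined by the two vertices x_b, y_b of G placed at each
   vertex b of H and by a bit for each of the 2k endpoint positions, telling
   which of x_b, y_b is v_i (w_i is the other one).  For fixed bits, (x, y) is
   a homomorphism into G of a 2-lift of H.  Call b twisted if its bits are not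
   all equal, i.e. if Condition 1 fails at b; there x_b and y_b have the same
   color, which costs a factor 1/C for each twisted vertex used.
   Building homomorphisms one vertex at a time, there are O(m^2 D^(2t-4)) of
   them, D being the maximum degree.  Since D^2 C <= m and C^3 <= m, this is
   enough if two vertices are twisted or if k > t.  Otherwise k = t and every
   vertex of H has degree 2, and a parity argument shows that a 2-lift with
   exactly one twisted vertex is connected, so that there are only
   m D^(2t-2) homomorphisms. *)

(** * Counting homomorphisms into a graph of bounded degree *)

Definition hom_set (W U : finType) (g : rel W) (e : rel U) :
    {set {ffun W -> U}} :=
  [set f : {ffun W -> U} | [forall x, forall y, g x y ==> e (f x) (f y)]].

Lemma hom_setP (W U : finType) (g : rel W) (e : rel U) (f : {ffun W -> U}) :
  reflect (forall x y, g x y -> e (f x) (f y)) (f \in hom_set g e).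
Proof.
rewrite inE; apply: (iffP idP) => [/forallP H x y|H].
  by move/forallP: (H x) => /(_ y)/implyP.
by apply/forallP => x; apply/forallP => y; apply/implyP/H.
Qed.

(** Values off A are [None], so that restrictions to all sets share one type. The image of [hom_set]
    under [restr A] counts only partial maps that extend to a full homomorphism. *)
Definition restr (W U : finType) (A : {set W}) (f : {ffun W -> U}) :
    {ffun W -> option U} :=
  [ffun z => if z \in A then Some (f z) else None].

Lemma card_bigcup_le (I U : finType) (P : pred I) (F : I -> {set U}) :
  (#|\bigcup_(i | P i) F i| <= \sum_(i | P i) #|F i|)%N.
Proof.
elim/big_rec2: _ => [|i n A _ IH]; first by rewrite cards0.
by apply: leq_trans (leq_card_setU _ _) _; rewrite leq_add2l.
Qed.

Lemma edge_leaving (W : finType) (g : rel W) (A : {set W}) (x z : W) :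
  connect g x z -> x \in A -> z \notin A ->
  exists p q, [/\ p \in A, q \notin A & g p q].
Proof.
case/connectP => s; elim: s x => [|y s IHs] x /=.
  by move=> _ -> ->.
case/andP=> gxy gs zE xA zA; case: (boolP (y \in A)) => yA.
  exact: IHs gs zE yA zA.
by exists x, y.
Qed.

(** Since q is adjacent to p, which is already placed, its image is one of at most D neighbors of
    the image of p. *)
Lemma card_restr_setU1 (W U : finType) (g : rel W) (e : rel U) (D : nat)
    (A : {set W}) (p q : W) :
  (forall u, degree e u <= D)%N -> p \in A -> g p q ->
  (#|restr (q |: A) @: hom_set g e| <= #|restr A @: hom_set g e| * D)%N.
Proof.
move=> degD pA gpq.
pose ext (r : {ffun W -> option U}) (u : U) :=
  [ffun z => if z == q then Some u else r z].
pose nb (r : {ffun W -> option U}) : {set U} :=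
  if r p is Some u then neighbors e u else set0.
apply: (@leq_trans #|\bigcup_(r in restr A @: hom_set g e) (ext r @: nb r)|).
  apply/subset_leq_card/subsetP => _ /imsetP[f fH ->].
  apply/bigcupP; exists (restr A f); first exact: imset_f.
  apply/imsetP; exists (f q).
    by rewrite /nb ffunE pA inE; apply: (hom_setP _ _ _ fH).
  by apply/ffunP => z; rewrite !ffunE in_setU1; case: eqP => [->|].
apply: (leq_trans (card_bigcup_le _ _)).
rewrite -sum_nat_const; apply: leq_sum => r _.
apply: (leq_trans (leq_imset_card _ _)); rewrite /nb.
by case: (r p) => [u|]; [exact: degD | rewrite cards0].
Qed.

Lemma card_restr_set2 (W U : finType) (g : rel W) (e : rel U) (x y : W) :
  g x y -> (#|restr [set x; y] @: hom_set g e| <= #|arc_set e|)%N.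
Proof.
move=> gxy.
pose pr (u : U * U) := [ffun z => if z == x then Some u.1
                                  else if z == y then Some u.2 else None].
apply: (@leq_trans #|pr @: arc_set e|); last exact: leq_imset_card.
apply/subset_leq_card/subsetP => _ /imsetP[f fH ->].
apply/imsetP; exists (f x, f y).
  by rewrite inE; apply: (hom_setP _ _ _ fH).
apply/ffunP => z; rewrite !ffunE !inE.
by case: eqP => [->|_] //=; case: eqP => [->|].
Qed.

(** A set grows from x, y by the far end of a leaving edge at each step: the first edge has at most
    as many images as there are arcs, and each later vertex costs a factor D. *)
Lemma card_hom_set (W U : finType) (g : rel W) (e : rel U) (D : nat)
    (x y : W) :
  (forall u, degree e u <= D)%N -> (forall z, connect g x z) ->
  x != y -> g x y ->
  (#|hom_set g e| <= #|arc_set e| * D ^ (#|W| - 2))%N.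
Proof.
move=> degD gconn xy gxy.
have grow n : (n <= #|W| - 2)%N -> exists A : {set W},
    [/\ x \in A, #|A| = n.+2 &
        (#|restr A @: hom_set g e| <= #|arc_set e| * D ^ n)%N].
  elim: n => [_|n IHn nW].
    exists [set x; y]; rewrite !inE eqxx cards2 xy expn0 muln1.
    by split=> //; exact: card_restr_set2.
  have [A [xA cA leA]] := IHn (ltnW nW).
  have /subsetPn[z _ zA] : ~~ ([set: W] \subset A).
    apply: contraL nW => /subset_leq_card; rewrite cardsT cA => leW.
    by rewrite -leqNgt leq_subLR add2n.
  have [p [q [pA qA gpq]]] := edge_leaving (gconn z) xA zA.
  exists (q |: A); rewrite in_setU1 xA orbT cardsU1 qA cA; split=> //.
  apply: (leq_trans (card_restr_setU1 degD pA gpq)).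
  by rewrite expnSr mulnA leq_mul2r leA orbT.
have [A [_ cA leA]] := grow _ (leqnn _).
have W2 : (2 <= #|W|)%N by have := max_card [set x; y]; rewrite cards2 xy.
have AT : A = [set: W].
  by apply/eqP; rewrite eqEcard subsetT cardsT cA -addn2 subnK ?leqnn.
apply: (leq_trans _ leA); rewrite card_imset // AT => f f' ff'.
apply/ffunP => z; have := congr1 (fun r : {ffun _} => r z) ff'.
by rewrite !ffunE in_setT => -[].
Qed.

(** * 2-lifts of H and the encoding of counted pairs *)

Definition mate (k : nat) (i : 'I_k * bool) : 'I_k * bool := (i.1, ~~ i.2).

Lemma mateK (k : nat) : involutive (@mate k).
Proof. by case=> j c; rewrite /mate /= negbK. Qed.

(* Vertex (b, c) of the 2-lift stands for x_b if c is false, for y_b if c is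
   true; arc i joins position [s i] at its tail to [s (mate i)] at its head, and
   the two complementary positions to each other. *)
Definition lift_rel (T : finType) (k : nat) (a : k.-tuple (T * T))
    (s : {ffun 'I_k * bool -> bool}) : rel (T * bool) :=
  fun p q => [exists i, [&& p.1 == endpoint a i, q.1 == endpoint a (mate i)
                          & p.2 (+) s i == q.2 (+) s (mate i)]].

Definition twisted (T : finType) (k : nat) (a : k.-tuple (T * T))
    (s : {ffun 'I_k * bool -> bool}) : {set T} :=
  [set b | [exists i in Gamma a b, exists j in Gamma a b, s i != s j]].

Lemma twistedPn (T : finType) (k : nat) (a : k.-tuple (T * T))
    (s : {ffun 'I_k * bool -> bool}) (b : T) :
  reflect {in Gamma a b &, forall i j, s i = s j} (b \notin twisted a s).
Proof.
rewrite inE negb_exists_in; apply: (iffP 'forall_in_idP) => H i.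
  move=> j iG jG; have := H i iG; rewrite negb_exists_in.
  by move/forall_inP/(_ j jG)/negPn/eqP.
move=> iG; rewrite negb_exists_in; apply/forall_inP => j jG.
by rewrite negbK; apply/eqP/H.
Qed.

Definition track (T V : finType) (k : nat) (a : k.-tuple (T * T))
    (F : {ffun T * bool -> V}) (s : 'I_k * bool -> bool) : k.-tuple (V * V) :=
  [tuple (F (endpoint a (j, false), s (j, false)),
          F (endpoint a (j, true), s (j, true))) | j < k].

(** The clauses together make F injective on B x bool, as independence of the colors needs different
    points. *)
Definition matched_colors (T V : finType) (C : nat) (B : {set T})
    (F : {ffun T * bool -> V}) (col : V -> 'I_C) : bool :=
  [forall b in B, (F (b, false) != F (b, true))
                  && (col (F (b, false)) == col (F (b, true)))]
  && [forall b in B, forall b' in B,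
        (b != b') ==> (col (F (b, false)) != col (F (b', false)))].

Lemma endpoint_inj (V : finType) (k : nat) (u v : k.-tuple (V * V)) :
  (forall i, endpoint u i = endpoint v i) -> u = v.
Proof.
move=> uv; apply: eq_from_tnth => j.
have := uv (j, false); have := uv (j, true); rewrite /endpoint /=.
by case: (tnth u j) (tnth v j) => [? ?] [? ?] /= -> ->.
Qed.

Lemma arc_tupleP (V : finType) (e : rel V) (k : nat) (u : k.-tuple (V * V)) :
  symmetric e -> arc_tuple e u ->
  forall i, e (endpoint u i) (endpoint u (mate i)).
Proof.
move=> esym /allP uE [j c].
have := uE _ (mem_tnth j u); rewrite !inE.
by case: c; rewrite /endpoint //= esym.
Qed.

Lemma endpoint_track (T V : finType) (k : nat) (a : k.-tuple (T * T))
    (F : {ffun T * bool -> V}) (s : 'I_k * bool -> bool) i :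
  endpoint (track a F s) i = F (endpoint a i, s i).
Proof. by case: i => j [] ; rewrite /endpoint tnth_mktuple. Qed.

Lemma in_Gamma (T : finType) (k : nat) (a : k.-tuple (T * T)) i :
  i \in Gamma a (endpoint a i).
Proof. by rewrite inE. Qed.

(* x_b and y_b are read off at one chosen occurrence of b, and [s i] records
   whether v_i differs from x_b. *)
Lemma counted_tupleP (T V : finType) (C k : nat) (e : rel V)
    (a : k.-tuple (T * T)) (col : V -> 'I_C) vw :
  symmetric e -> vw \in counted_tuples e a col ->
  exists (F : {ffun T * bool -> V}) (s : {ffun 'I_k * bool -> bool}),
    [/\ vw = (track a F s, track a F (fun i => ~~ s i)),
        F \in hom_set (lift_rel a s) e,
        twisted a s != set0 & matched_colors (twisted a s) F col].
Proof.
case: vw => v w esym; rewrite inE /=.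
case/and5P => ve we vc wc /andP[/forallP c13 nc1].
have {}ve := arc_tupleP esym ve; have {}we := arc_tupleP esym we.
have [i00 _] : exists i : 'I_k * bool, true.
  move: nc1; rewrite negb_forall => /existsP[b].
  rewrite negb_forall_in => /exists_inP[i _ _]; by exists i.
pose pk b := odflt i00 [pick i in Gamma a b].
have pkG i : pk (endpoint a i) \in Gamma a (endpoint a i).
  rewrite /pk; case: pickP => [//|/(_ i)]; by rewrite in_Gamma.
pose F : {ffun T * bool -> V} :=
  [ffun p => if p.2 then endpoint w (pk p.1) else endpoint v (pk p.1)].
pose s := [ffun i => endpoint v i != endpoint v (pk (endpoint a i))].
have vwF i : endpoint v i = F (endpoint a i, s i)
          /\ endpoint w i = F (endpoint a i, ~~ s i).
  rewrite !ffunE /= negbK.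
  have := in_Gamma a i; have := pkG i; move: (endpoint a i) => b pkb iG.
  have/orP[/forall_inP/(_ i iG)/forall_inP/(_ _ pkb)/andP[]|] := c13 b.
    by move=> /eqP -> /eqP ->; rewrite eqxx.
  case/existsP=> x /existsP[y] /forall_inP H.
  (* The order of x and y may agree or differ at i and at the chosen position; if it differs, x = y
     is still possible and gives the bit [false]. *)
  move: (H _ iG) (H _ pkb).
  case/orP=> /andP[/eqP-> /eqP->]; case/orP=> /andP[/eqP-> /eqP->];
    rewrite ?eqxx //; by case: eqP => [->|].
have tw b : b \in twisted a s -> F (b, false) != F (b, true) /\
    exists i j, [/\ i \in Gamma a b, j \in Gamma a b,
      endpoint v i = F (b, false) & endpoint v j = F (b, true)].
  rewrite inE => /exists_inP[i iG] /exists_inP[j jG].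
  move=> sij; have {i j iG jG sij} [i [j [iG jG si sj]]] : exists i j,
      [/\ i \in Gamma a b, j \in Gamma a b, s i = false & s j = true].
    case si: (s i) sij; case sj: (s j) => // _; first by exists j, i.
    by exists i, j.
  have bi : endpoint a i = b by move: iG; rewrite inE => /eqP.
  have bj : endpoint a j = b by move: jG; rewrite inE => /eqP.
  have [vi _] := vwF i; have [vj _] := vwF j.
  rewrite bi si in vi; rewrite bj sj in vj.
  split; last by exists i, j.
  rewrite -vj -bj ffunE /= eq_sym; by rewrite ffunE in sj.
exists F, s; split.
- congr pair; apply: endpoint_inj => i; rewrite endpoint_track;
    by have [] := vwF i.
- apply/hom_setP => -[b c] [b' c'] /existsP[i] /and3P[/= /eqP-> /eqP->].
  have [vi wi] := vwF i; have [vi' wi'] := vwF (mate i).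
  have := ve i; have := we i; rewrite vi wi vi' wi'.
  by case: c; case: (s i); case: c'; case: (s (mate i)).
- apply: contra nc1 => /eqP tw0; apply/forallP => b.
  apply/forall_inP => i iG; apply/forall_inP => j jG.
  have /twistedPn/(_ i j iG jG) sij : b \notin twisted a s by rewrite tw0 inE.
  have [-> ->] := vwF i; have [-> ->] := vwF j.
  move: iG jG; rewrite !inE => /eqP -> /eqP ->; by rewrite sij !eqxx.
(* Both points over a twisted b occur among the v_i, so they share the color c b, and injectivity of
   c separates different vertices. *)
- case/existsP: vc => c /andP[/injectiveP cinj /forallP cE].
  have colF b : b \in twisted a s ->
      col (F (b, false)) = c b /\ col (F (b, true)) = c b.
    case/tw=> _ [i [j [iG jG <- <-]]]; rewrite !(eqP (cE _)).
    by move: iG jG; rewrite !inE => /eqP -> /eqP ->.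
  apply/andP; split; apply/forall_inP => b bt.
    by have [-> _] := tw b bt; have [-> ->] := colF b bt; rewrite eqxx.
  apply/forall_inP => b' b't; apply/implyP; apply: contra => /eqP.
  by have [-> _] := colF b bt; have [-> _] := colF b' b't => /cinj ->.
Qed.

(** * Probability that a random coloring matches given pairs *)

Lemma card_coloring_eq (R : realType) (q : nat) (S V : finType) (C : nat)
    (h : S -> V -> 'I_C) (A : {set V}) (f : V -> 'I_C) :
  (0 < #|S|)%N -> (0 < C)%N -> wise_independent R q h -> uniform_values R h ->
  (#|A| <= q)%N ->
  (#|[set s | [forall x in A, h s x == f x]]| * C ^ #|A| = #|S|)%N.
Proof.
move=> S0 C0 indep unif Aq; have := indep A f Aq.
rewrite (eq_bigr (fun=> C%:R^-1)); last by move=> x _; exact: unif.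
rewrite prodr_const /prob => /(congr1 (fun z => z * (#|S|%:R * C%:R ^+ #|A|))).
have S1 : #|S|%:R != 0 :> R by rewrite pnatr_eq0 -lt0n.
have C1 : C%:R ^+ #|A| != 0 :> R by rewrite expf_neq0 // pnatr_eq0 -lt0n.
rewrite mulrA divfK // exprVn [RHS]mulrCA mulVf // mulr1.
by rewrite -natrX -natrM => /eqP; rewrite eqr_nat => /eqP.
Qed.

(** The 2|D| points are different and receive one of C^|D| patterns of common colors, each with
    probability C^(-2|D|). Taking D inside B lets the number of coincidences used be chosen. *)
Lemma card_matched_colors (R : realType) (q : nat) (S T V : finType) (C : nat)
    (h : S -> V -> 'I_C) (B D : {set T}) (F : {ffun T * bool -> V}) :
  (0 < #|S|)%N -> (0 < C)%N -> wise_independent R q h -> uniform_values R h ->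
  D \subset B -> (#|D| * 2 <= q)%N ->
  (#|[set s | matched_colors B F (h s)]| * C ^ #|D| <= #|S|)%N.
Proof.
move=> S0 C0 indep unif /subsetP DB Dq.
(* F does not depend on the seed, so one matching seed [s0] suffices to show that F is injective on
   D x bool. *)
have [->|[s0]] := set_0Vmem [set s | matched_colors B F (h s)].
  by rewrite cards0 mul0n.
rewrite inE => /andP[/forall_inP Fs0 /forall_inP Fd0].
have Finj : {in setX D [set: bool] &, injective F}.
  move=> [b c] [b' c']; rewrite !inE !andbT /= => bD b'D FE.
  have colE b1 c1 : b1 \in D -> h s0 (F (b1, c1)) = h s0 (F (b1, false)).
    by move=> /DB/Fs0/andP[_ /eqP E]; case: c1.
  have bb' : b = b'.
    apply/eqP; apply: contraT => nbb'.
    have /implyP/(_ nbb') := forall_inP (Fd0 b (DB b bD)) b' (DB b' b'D).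
    by rewrite -(colE b c) // FE colE // eqxx.
  move: FE; rewrite -bb' => FE; congr pair.
  have /andP[+ _] := Fs0 b (DB b bD).
  by case: c c' FE => [] [] //= ->; rewrite eqxx.
pose A := F @: setX D [set: bool].
have cA : #|A| = (#|D| * 2)%N.
  by rewrite card_in_imset // cardsX cardsT card_bool.
pose c0 : 'I_C := Ordinal C0.
(* [f g] gives both points over b in D the color g b; [c0] is its value off A. *)
pose f (g : {ffun T -> 'I_C}) x :=
  if [pick p in setX D [set: bool] | F p == x] is Some p then g p.1 else c0.
have fE (g : {ffun T -> 'I_C}) p : p \in setX D [set: bool] ->
    f g (F p) = g p.1.
  move=> pD; rewrite /f; case: pickP => [p' /andP[p'D /eqP /Finj ->] //|].
  by move/(_ p); rewrite pD eqxx.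
pose G := pffun_on c0 (mem D) (mem [set: 'I_C]).
have cG : #|G| = (C ^ #|D|)%N by rewrite card_pffun_on cardsT card_ord.
(* After multiplication by C^|D| the exponent is |A|, and the right side becomes a sum over G in
   which each term |S| is the exact count for g. *)
rewrite -(leq_pmul2r (m := C ^ #|D|)) ?expn_gt0 ?C0 // -mulnA -expnD addnn.
rewrite -muln2 -cA -cG [leqRHS]mulnC -[leqRHS]sum_nat_const.
rewrite (eq_bigr (fun g => #|[set s | [forall x in A, h s x == f g x]]|
                           * C ^ #|A|))%N; last first.
  by move=> g _; rewrite (card_coloring_eq (f g) S0 C0 indep unif) ?cA.
rewrite -big_distrl /= leq_mul2r; apply/orP; right.
apply: (leq_trans _ (card_bigcup_le _ _)).
apply/subset_leq_card/subsetP => s; rewrite inE => /andP[/forall_inP Fs _].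
apply/bigcupP; exists [ffun b => if b \in D then h s (F (b, false)) else c0].
  apply/pffun_onP; split.
    apply/subsetP => b; rewrite !inE ffunE.
    by case: ifP => //; rewrite eqxx.
  by move=> x _; rewrite inE.
rewrite inE; apply/forall_inP => _ /imsetP[[b c] pD ->].
rewrite fE //= ffunE; move: pD; rewrite !inE andbT /= => bD; rewrite bD.
by have /andP[_ /eqP E] := Fs b (DB b bD); case: c; rewrite ?E.
Qed.

(** * Orientations and degrees of H *)

Lemma eq_set2 (T : finType) (x y z w : T) :
  [set x; y] = [set z; w] -> x != y -> z = x /\ w = y \/ z = y /\ w = x.
Proof.
move=> E xy; move/setP: E => E.
have := E x; rewrite !inE eqxx => /esym/orP[]/eqP xE.
  left; have := E y; rewrite !inE eqxx orbT -xE eq_sym (negPf xy) /=.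
  by move=> /esym/eqP ->.
right; have := E y; rewrite !inE eqxx orbT -xE orbC eq_sym (negPf xy) /=.
by move=> /esym/eqP ->.
Qed.

Lemma orientation_dart (T : finType) (e : rel T) (k : nat)
    (a : k.-tuple (T * T)) :
  simple_graph e -> orientation e a ->
  forall i, e (endpoint a i) (endpoint a (mate i)).
Proof.
move=> [e_sym e_irr] /perm_mem aE.
apply: arc_tupleP => //; apply/allP => p pa; rewrite !inE.
have : [set p.1; p.2] \in enum (edge_set e).
  by rewrite -aE; exact: (map_f (fun p : T * T => [set p.1; p.2]) pa).
rewrite mem_enum => /imsetP[q]; rewrite inE => eq /esym/eq_set2 [].
- by apply: contraTneq eq => ->; rewrite e_irr.
- by case=> -> ->.
- by case=> -> ->; rewrite e_sym.
Qed.

Lemma orientation_edge (T : finType) (e : rel T) (k : nat)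
    (a : k.-tuple (T * T)) (x y : T) :
  irreflexive e -> orientation e a -> e x y ->
  exists i, endpoint a i = x /\ endpoint a (mate i) = y.
Proof.
move=> e_irr /perm_mem aE exy.
have : [set x; y] \in enum (edge_set e).
  by rewrite mem_enum; apply/imsetP; exists (x, y); rewrite ?inE.
rewrite -aE => /mapP[p /tnthP[j pj] /eq_set2 []].
- by apply: contraTneq exy => ->; rewrite e_irr.
- by case=> <- <-; exists (j, false); rewrite /endpoint /= -pj.
- by case=> <- <-; exists (j, true); rewrite /endpoint /= -pj.
Qed.

Lemma degree_le_Gamma (T : finType) (e : rel T) (k : nat)
    (a : k.-tuple (T * T)) (b : T) :
  irreflexive e -> orientation e a -> (degree e b <= #|Gamma a b|)%N.
Proof.
move=> e_irr aE.
apply: leq_trans (leq_imset_card (fun i => endpoint a (mate i)) (Gamma a b)).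
apply/subset_leq_card/subsetP => y; rewrite inE.
case/(orientation_edge e_irr aE) => i [ib <-].
by apply/imsetP; exists i; rewrite // inE ib.
Qed.

Lemma sum_card_Gamma (T : finType) (k : nat) (a : k.-tuple (T * T)) :
  (\sum_b #|Gamma a b| = k * 2)%N.
Proof.
have <- : #|{: 'I_k * bool}| = (k * 2)%N.
  by rewrite card_prod card_ord card_bool.
rewrite -sum1_card (partition_big (endpoint a) predT) //=.
by apply: eq_bigr => b _; rewrite sum1dep_card.
Qed.

(** The edge xy supplies a vertex other than b, so connectedness gives b a neighbor, and b is not a
    leaf. *)
Lemma degree_gt1 (T : finType) (e : rel T) (x y b : T) :
  simple_graph e -> connected_graph e -> no_leaves e -> e x y ->
  (1 < degree e b)%N.
Proof.
move=> [e_sym e_irr] [_ econn] leaf exy.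
have [z zb] : exists z, z != b.
  case: (eqVneq x b) => [xb|]; last by exists x.
  by exists y; rewrite -xb; apply: contraTneq exy => ->; rewrite e_irr.
have [||p [q [+ _ ebq]]] := @edge_leaving T e [set b] b z (econn b z);
  rewrite ?inE // => /eqP pb.
rewrite pb in ebq; rewrite ltn_neqAle eq_sym; apply/andP; split.
  exact/eqP/leaf.
by rewrite card_gt0; apply/set0Pn; exists q; rewrite inE.
Qed.

Lemma Gamma_gt1 (T : finType) (e : rel T) (k : nat) (a : k.-tuple (T * T))
    (i : 'I_k * bool) (b : T) :
  simple_graph e -> connected_graph e -> no_leaves e -> orientation e a ->
  (1 < #|Gamma a b|)%N.
Proof.
move=> simple conn leaf aE; apply: leq_trans (degree_le_Gamma b simple.2 aE).
exact: degree_gt1 simple conn leaf (orientation_dart simple aE i).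
Qed.

(** Handshake count: 2t is at most the sum of the |Gamma a b|, which is 2k. *)
Lemma card_le_edges (T : finType) (k : nat) (a : k.-tuple (T * T)) :
  (forall b, 1 < #|Gamma a b|)%N -> (#|T| <= k)%N.
Proof.
move=> G2; rewrite -(leq_pmul2r (m := 2)) // -(sum_card_Gamma a) -sum_nat_const.
exact: leq_sum.
Qed.

Lemma Gamma_eq2 (T : finType) (k : nat) (a : k.-tuple (T * T)) :
  (forall b, 1 < #|Gamma a b|)%N -> k = #|T| -> forall b, #|Gamma a b| = 2.
Proof.
move=> G2 kT b; apply/eqP.
have : (\sum_b (#|Gamma a b| - 2) == 0)%N.
  rewrite sumnB; last by move=> c _; exact: G2.
  by rewrite sum_card_Gamma sum_nat_const kT subnn.
rewrite sum_nat_eq0 => /forall_inP/(_ b isT).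
by rewrite subn_eq0 eqn_leq G2 andbT.
Qed.

(** * Homomorphisms of an arbitrary 2-lift *)

(* H is mapped by b |-> (x_b, y_b); crossed arcs are allowed at the price of a
   factor 2. *)
Definition pair_rel (V : finType) (e : rel V) : rel (V * V) :=
  fun p q => (e p.1 q.1 && e p.2 q.2) || (e p.1 q.2 && e p.2 q.1).

Lemma degree_pair_rel (V : finType) (e : rel V) (D : nat) :
  (forall u, degree e u <= D)%N ->
  forall p, (degree (pair_rel e) p <= 2 * D ^ 2)%N.
Proof.
move=> degD p.
pose A := setX (neighbors e p.1) (neighbors e p.2).
pose B := setX (neighbors e p.2) (neighbors e p.1).
apply: (@leq_trans #|A :|: B|).
  apply/subset_leq_card/subsetP => q; rewrite !inE.
  by case/orP=> /andP[-> ->]; rewrite ?orbT.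
apply: leq_trans (leq_card_setU _ _) _.
by rewrite !cardsX mul2n -addnn expnSr expn1 leq_add // leq_mul // degD.
Qed.

Lemma card_arcs_pair_rel (V : finType) (e : rel V) :
  (#|arc_set (pair_rel e)| <= 2 * #|arc_set e| ^ 2)%N.
Proof.
pose f (u : (V * V) * (V * V)) := ((u.1.1, u.2.1), (u.1.2, u.2.2)).
pose g (u : (V * V) * (V * V)) := ((u.1.1, u.2.1), (u.2.2, u.1.2)).
pose A := setX (arc_set e) (arc_set e).
apply: (@leq_trans #|f @: A :|: g @: A|).
  apply/subset_leq_card/subsetP => -[[p1 p2] [q1 q2]]; rewrite !inE.
  case/orP=> /= /andP[e1 e2]; apply/orP; [left|right]; apply/imsetP.
    by exists ((p1, q1), (p2, q2)); rewrite // !inE e1 e2.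
  by exists ((p1, q2), (p2, q1)); rewrite // !inE e1 e2.
apply: leq_trans (leq_card_setU _ _) _.
by rewrite mul2n -addnn expnSr expn1 -cardsX leq_add // leq_imset_card.
Qed.

(** Above an arc of H the two arcs of the lift are parallel or crossed according to the bits, so b
    |-> (F (b, false), F (b, true)) is a homomorphism from H to [pair_rel e]. This asks for
    connectedness of H, not of the lift. *)
Lemma card_hom_lift (T V : finType) (eH : rel T) (e : rel V) (k : nat)
    (a : k.-tuple (T * T)) (s : {ffun 'I_k * bool -> bool}) (D : nat)
    (x y : T) :
  simple_graph eH -> connected_graph eH -> orientation eH a -> eH x y ->
  (forall u, degree e u <= D)%N ->
  (#|hom_set (lift_rel a s) e|
     <= 2 * #|arc_set e| ^ 2 * (2 * D ^ 2) ^ (#|T| - 2))%N.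
Proof.
move=> [e_sym e_irr] [_ econn] aE exy degD.
pose f (F : {ffun T * bool -> V}) := [ffun b => (F (b, false), F (b, true))].
have finj : injective f.
  move=> F F' /ffunP FF; apply/ffunP => -[b c].
  by have := FF b; rewrite !ffunE => -[]; case: c.
have xy : x != y by apply: contraTneq exy => ->; rewrite e_irr.
rewrite -(card_imset _ finj).
apply: (@leq_trans #|hom_set eH (pair_rel e)|).
  apply/subset_leq_card/subsetP => _ /imsetP[F /hom_setP FH ->].
  apply/hom_setP => b b' /(orientation_edge e_irr aE)[i [<- <-]].
  have L c : lift_rel a s (endpoint a i, c (+) s i)
                          (endpoint a (mate i), c (+) s (mate i)).
    by apply/existsP; exists i; rewrite /= !addbK !eqxx.
  have := FH _ _ (L false); have := FH _ _ (L true).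
  rewrite /pair_rel !ffunE /=.
  by case: (s i); case: (s (mate i)) => /= -> ->; rewrite ?orbT.
apply: (leq_trans (card_hom_set (degree_pair_rel degD) (econn x) xy exy)).
by rewrite leq_mul2r card_arcs_pair_rel orbT.
Qed.

(** * Connectedness of a 2-lift with one twisted vertex *)

Definition flip (T : finType) (p : T * bool) := (p.1, ~~ p.2).

Lemma lift_rel_sym (T : finType) (k : nat) (a : k.-tuple (T * T))
    (s : {ffun 'I_k * bool -> bool}) : symmetric (lift_rel a s).
Proof.
have L p q : lift_rel a s p q -> lift_rel a s q p.
  case/existsP=> i /and3P[ip iq E]; apply/existsP; exists (mate i).
  by rewrite mateK iq ip eq_sym.
by move=> p q; apply/idP/idP; exact: L.
Qed.

(** Exchanging the two sheets is an automorphism of the lift. *)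
Lemma connect_flip (T : finType) (k : nat) (a : k.-tuple (T * T))
    (s : {ffun 'I_k * bool -> bool}) (p q : T * bool) :
  connect (lift_rel a s) p q -> connect (lift_rel a s) (flip p) (flip q).
Proof.
case/connectP => l; elim: l p => [|r l IHl] p /= => [_ -> //|].
case/andP=> /existsP[i /and3P[ip iq /eqP E]] lr /(IHl _ lr).
apply: connect_trans; apply/connect1/existsP; exists i.
by rewrite ip iq /= !addNb E.
Qed.

(** Path lifting: the bits of each arc tell on which sheet to continue. *)
Lemma connect_lift (T : finType) (eH : rel T) (k : nat)
    (a : k.-tuple (T * T)) (s : {ffun 'I_k * bool -> bool}) (b b' : T) c :
  irreflexive eH -> orientation eH a -> connect eH b b' ->
  exists c', connect (lift_rel a s) (b, c) (b', c').
Proof.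
move=> e_irr aE /connectP[l]; elim: l b c => [|x l IHl] b c /=.
  by move=> _ ->; exists c.
case/andP=> /(orientation_edge e_irr aE)[i [ib ix]] lr /(IHl x _ lr) {}IHl.
have [c' xc'] := IHl (c (+) s i (+) s (mate i)); exists c'.
apply: connect_trans xc'; apply/connect1/existsP; exists i.
by rewrite /= ib ix !eqxx /= -addbA addbb addbF.
Qed.

(* Here [rho] is a section of the lift.  Each arc contributes equally at its two
   ends, so the total parity of the values [rho (a_i) + s i] is even; grouping
   them by the vertex [a_i], the terms [rho] cancel and a vertex contributes 1
   iff it is twisted. *)
Lemma twisted_even (T : finType) (k : nat) (a : k.-tuple (T * T))
    (s : {ffun 'I_k * bool -> bool}) (rho : T -> bool) :
  (forall b, #|Gamma a b| = 2) ->
  (forall i, rho (endpoint a i) (+) s i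
             = rho (endpoint a (mate i)) (+) s (mate i)) ->
  \big[addb/false]_b (b \in twisted a s) = false.
Proof.
move=> G2 rhoE.
pose g i := rho (endpoint a i) (+) s i.
have g0 : \big[addb/false]_i g i = false.
  rewrite (eq_bigr (fun p => g (p.1, p.2))); last by case.
  rewrite -(pair_bigA _ (fun j c => g (j, c))) /=; apply: big1 => j _.
  by rewrite big_bool /g (rhoE (j, true)); exact: addbb.
rewrite -[RHS]g0 (partition_big (endpoint a) predT) //=; apply: eq_bigr => b _.
have /cards2P[i [j [ij GE]]] : #|Gamma a b| == 2 by rewrite G2.
rewrite (eq_bigl (mem (Gamma a b))); last by move=> l; rewrite !inE.
rewrite GE big_setU1; last by rewrite inE.
rewrite big_set1 /g /=.
have iG : i \in Gamma a b by rewrite GE !inE eqxx.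
have jG : j \in Gamma a b by rewrite GE !inE eqxx orbT.
have ib : endpoint a i = b by move: iG; rewrite inE => /eqP.
have jb : endpoint a j = b by move: jG; rewrite inE => /eqP.
rewrite ib jb addbACA addbb /=.
have [|/twistedPn/(_ i j iG jG) ->] := boolP (b \in twisted a s); last first.
  by rewrite addbb.
rewrite inE GE => /exists_inP[i' + /exists_inP[j']].
rewrite !inE => /orP[]/eqP-> /orP[]/eqP->; rewrite ?eqxx //.
  by case: (s i); case: (s j).
by case: (s i); case: (s j).
Qed.

(** Otherwise the component of (b0, false) is a section of the lift, and [twisted_even] makes the
    number of twisted vertices even, not 1. *)
Lemma lift_connected (T : finType) (eH : rel T) (k : nat)
    (a : k.-tuple (T * T)) (s : {ffun 'I_k * bool -> bool}) (b0 : T) :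
  irreflexive eH -> connected_graph eH -> orientation eH a ->
  (forall b, #|Gamma a b| = 2) -> twisted a s = [set b0] ->
  forall p q, connect (lift_rel a s) p q.
Proof.
move=> e_irr [_ econn] aE G2 tw.
set L := lift_rel a s.
have Lsym := sym_connect_sym (lift_rel_sym a s).
have [conn|nconn] := boolP (connect L (b0, false) (b0, true)).
  have toall p : connect L (b0, false) p.
    case: p => b c.
    have [c' cc'] := connect_lift s false e_irr aE (econn b0 b).
    have [<-//|nc] := eqVneq c' c.
    have -> : (b, c) = flip (b, c') by case: c c' nc {cc'} => [] [].
    exact: connect_trans conn (connect_flip cc').
  move=> p q; apply: connect_trans (toall q); rewrite Lsym; exact: toall.
(* [rho b] is the sheet of the only point over b in the component of (b0, false): path lifting gives
   one, and two would join the points over b0 by [connect_flip]. *)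
pose rho b := connect L (b0, false) (b, true).
have rhoP b c : connect L (b0, false) (b, c) = (rho b == c).
  have [c' cc'] := connect_lift s false e_irr aE (econn b0 b).
  have one : ~~ (connect L (b0, false) (b, false) && rho b).
    apply: contra nconn => /andP[cf ct]; apply: connect_trans cf _.
    by have := connect_flip ct; rewrite Lsym.
  case: c; first by rewrite eqb_id.
  rewrite eqbF_neg; apply/idP/idP => [cf|nr].
    by apply: contra one => ->; rewrite cf.
  by case: c' cc' => // ct; rewrite /rho ct in nr.
have rhoE i : rho (endpoint a i) (+) s i
              = rho (endpoint a (mate i)) (+) s (mate i).
  have : connect L (b0, false) (endpoint a i, rho (endpoint a i)).
    by rewrite rhoP.
  move/connect_trans/(_ (connect1 _)) => /(_ (endpoint a (mate i),
    rho (endpoint a i) (+) s i (+) s (mate i))).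
  rewrite rhoP => /(_ _)/eqP ->; first by rewrite -addbA addbb addbF.
  by apply/existsP; exists i; rewrite /= !eqxx -addbA addbb addbF /=.
have := twisted_even G2 rhoE; rewrite tw (bigD1 b0) //= inE eqxx big1 //.
by move=> b /negPf bb0; rewrite inE.
Qed.

(** One starting arc now serves all 2t vertices. Compared with m^2 D^(2t-4), a factor m is replaced
    by D^2, which gains the factor C that a second twisted vertex would give. *)
Lemma card_hom_lift_connected (T V : finType) (eH : rel T) (e : rel V)
    (k : nat) (a : k.-tuple (T * T)) (s : {ffun 'I_k * bool -> bool})
    (D : nat) (x y b0 : T) :
  simple_graph eH -> connected_graph eH -> orientation eH a -> eH x y ->
  (forall b, #|Gamma a b| = 2) -> twisted a s = [set b0] ->
  (forall u, degree e u <= D)%N ->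
  (#|hom_set (lift_rel a s) e| <= #|arc_set e| * D ^ (#|T| * 2 - 2))%N.
Proof.
move=> [_ e_irr] econn aE exy G2 tw degD.
have conn := lift_connected e_irr econn aE G2 tw.
have xy : x != y by apply: contraTneq exy => ->; rewrite e_irr.
have [i [ix iy]] := orientation_edge e_irr aE exy.
have -> : (#|T| * 2)%N = #|{: T * bool}| by rewrite card_prod card_bool.
apply: (@card_hom_set _ _ _ _ _ (x, s i) (y, s (mate i))) => //.
  by apply: contraNneq xy => -[->].
by apply/existsP; exists i; rewrite /= ix iy !eqxx !addbb.
Qed.

(** * Arithmetic of the exponents *)

Lemma sqr_degree_le (R : realType) (m D C : nat) (alpha : R) :
  (0 < C)%N -> D%:R <= m%:R `^ (1 / 2%:R - alpha) ->
  C%:R <= Num.min (m%:R `^ (2%:R * alpha)) (m%:R `^ (1 / 3%:R)) ->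
  (D ^ 2 * C <= m)%N /\ (C ^ 3 <= m)%N.
Proof.
move=> C0 Dm; rewrite le_min => /andP[C1 C2].
have R3 : 3%:R != 0 :> R by rewrite pnatr_eq0.
(* For m = 0 the power m^(1/3) is 0, against 0 < C. *)
have m0 : (0 < m)%N.
  rewrite lt0n; apply: contraTneq C2 => ->.
  by rewrite powR0 ?mulf_neq0 ?invr_eq0 ?oner_eq0 // -ltNge ltr0n.
have mR : m%:R != 0 :> R by rewrite pnatr_eq0 -lt0n.
split; rewrite -(ler_nat R).
  (* D^2 is at most m^(1 - 2 alpha) and C at most m^(2 alpha), so [alpha] cancels in the product. *)
  rewrite natrM natrX.
  apply: (@le_trans _ _ ((m%:R `^ (1 / 2%:R - alpha)) ^+ 2
                           * m%:R `^ (2%:R * alpha))).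
    by rewrite ler_pM ?exprn_ge0 // lerXn2r // nnegrE ?powR_ge0.
  rewrite -powR_mulrn ?powR_ge0 // -powRrM -powRD; last by rewrite mR implybT.
  rewrite mulrBl mul1r mulVf ?pnatr_eq0 // [alpha * _]mulrC subrK powRr1 //.
rewrite natrX; apply: (@le_trans _ _ ((m%:R `^ (1 / 3%:R)) ^+ 3)).
  by rewrite lerXn2r // nnegrE ?powR_ge0.
by rewrite -powR_mulrn ?powR_ge0 // -powRrM mul1r mulVf // powRr1.
Qed.

(* [d] is the number of twisted vertices whose color coincidence is used. *)
Lemma leq_expn_budget (m D C t k d : nat) :
  (0 < C)%N -> (D ^ 2 * C <= m)%N -> (C ^ 3 <= m)%N ->
  (2 <= t <= k)%N -> (d <= 2)%N -> (2 * (k - t) + 2 - d <= 3 * (k - t))%N ->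
  (m ^ 2 * (D ^ 2) ^ (t - 2) * C ^ (k * 2 - t - d) <= m ^ k)%N.
Proof.
move=> C0 DC C3 /andP[t2 tk] d2 le.
(* Here t-2 factors C pair with the factors D^2; the others are absorbed by k-t factors m, each at
   least C^3. *)
have -> : (k * 2 - t - d = (t - 2) + (2 * (k - t) + 2 - d))%N by lia.
rewrite expnD mulnA -(mulnA (m ^ 2)%N) -expnMn.
have -> : (m ^ k = m ^ 2 * m ^ (t - 2) * m ^ (k - t))%N.
  by rewrite -!expnD; congr expn; lia.
rewrite !leq_mul //; first by case: (t - 2)%N => // n; rewrite leq_exp2r.
apply: (@leq_trans (C ^ (3 * (k - t)))); first exact: leq_pexp2l.
by rewrite expnM; case: (k - t)%N => // n; rewrite leq_exp2r.
Qed.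

(** * Summation over homomorphisms and bit patterns *)

Lemma sum_card_pairs (I J : finType) (A : {set I}) (r : I -> J -> bool) :
  (\sum_(j : J) #|[set i in A | r i j]| = \sum_(i in A) #|[set j | r i j]|)%N.
Proof.
under eq_bigr do rewrite -sum1dep_card.
under [RHS]eq_bigr do rewrite -sum1dep_card.
rewrite (exchange_big_dep (mem A)) //=; last by move=> j i _ /andP[].
apply: eq_bigr => i iA; by apply: eq_bigl => j; rewrite iA.
Qed.

(** After exchanging the sums, each F counts for at most |S| / C^d seeds: the colors pay for d of
    the n factors C, the bound on |A| for the others. *)
Lemma sum_matched_le (S T V : finType) (C d n M : nat) (h : S -> V -> 'I_C)
    (B : {set T}) (A : {set {ffun T * bool -> V}}) :
  (forall F, #|[set s | matched_colors B F (h s)]| * C ^ d <= #|S|)%N ->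
  (d <= n)%N -> (#|A| * C ^ (n - d) <= M)%N ->
  ((\sum_s #|[set F in A | matched_colors B F (h s)]|) * C ^ n <= M * #|S|)%N.
Proof.
move=> hd dn AM; rewrite sum_card_pairs -(subnK dn) expnD.
rewrite mulnCA (leq_trans _ (leq_mul AM (leqnn #|S|))) //.
rewrite [leqRHS]mulnAC [leqRHS]mulnC leq_mul2l; apply/orP; right.
by rewrite big_distrl /= -sum_nat_const; apply: leq_sum => F _.
Qed.

Lemma sum_matched_lift_le (R : realType) (S T V : finType) (C k : nat)
    (h : S -> V -> 'I_C) (eH : rel T) (e : rel V) (a : k.-tuple (T * T))
    (s : {ffun 'I_k * bool -> bool}) (D : nat) :
  simple_graph eH -> connected_graph eH -> no_leaves eH -> orientation eH a ->
  (0 < #|S|)%N -> (0 < C)%N ->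
  wise_independent R (4 * k) h -> uniform_values R h ->
  (forall u, degree e u <= D)%N ->
  (D ^ 2 * C <= #|arc_set e|)%N -> (C ^ 3 <= #|arc_set e|)%N ->
  twisted a s != set0 ->
  ((\sum_z #|[set F in hom_set (lift_rel a s) e
                | matched_colors (twisted a s) F (h z)]|) * C ^ (k * 2 - #|T|)
     <= 2 ^ #|T| * #|arc_set e| ^ k * #|S|)%N.
Proof.
move=> simpH connH leafH aE S0 C0 indep unif degD DC C3 /set0Pn[b0 b0t].
have [i0 _] : exists i : 'I_k * bool, true.
  by move: b0t; rewrite inE => /exists_inP[i _ _]; exists i.
have k0 : (0 < k)%N := leq_ltn_trans (leq0n i0.1) (ltn_ord i0.1).
have exy := orientation_dart simpH aE i0.
set x := endpoint a i0 in exy; set y := endpoint a (mate i0) in exy.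
have e_irr := simpH.2.
have G2 b := Gamma_gt1 i0 b simpH connH leafH aE.
have Tk := card_le_edges G2.
have xy : x != y by apply: contraTneq exy => ->; rewrite e_irr.
have T2 : (2 <= #|T|)%N by have := max_card [set x; y]; rewrite cards2 xy.
have generic (d : nat) (B : {set T}) : B \subset twisted a s -> #|B| = d ->
    (d <= 2)%N -> (2 * (k - #|T|) + 2 - d <= 3 * (k - #|T|))%N ->
    ((\sum_z #|[set F in hom_set (lift_rel a s) e
                | matched_colors (twisted a s) F (h z)]|) * C ^ (k * 2 - #|T|)
     <= 2 ^ #|T| * #|arc_set e| ^ k * #|S|)%N.
  move=> Bt Bd d2 dk; apply: (@sum_matched_le _ _ _ _ d).
  - move=> F; rewrite -Bd.
    by apply: (card_matched_colors F S0 C0 indep unif Bt); rewrite Bd; lia.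
  - by lia.
  have := leq_expn_budget C0 DC C3 (introT andP (conj T2 Tk)) d2 dk.
  move=> le; apply: (leq_trans _ (leq_mul (leqnn (2 ^ #|T|)%N) le)).
  rewrite mulnA leq_mul2r; apply/orP; right.
  apply: leq_trans (card_hom_lift s simpH connH aE exy degD) _.
  rewrite expnMn.
  apply: (@leq_trans (2 ^ (#|T| - 2).+1
                    * (#|arc_set e| ^ 2 * (D ^ 2) ^ (#|T| - 2)))).
    by rewrite (expnS 2) mulnACA.
  by rewrite leq_mul2r leq_pexp2l ?orbT //; lia.
have [b1|tw1] := altP (@set0Pn _ (twisted a s :\ b0)).
  case: b1 => b1 /setD1P[b10 b1t].
  apply: (generic 2 [set b0; b1]) => //; last by lia.
    by rewrite subUset !sub1set b0t.
  by rewrite cards2 eq_sym b10.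
have tw : twisted a s = [set b0].
  apply/eqP; rewrite eqEsubset sub1set b0t andbT -setD_eq0.
  by move: tw1; rewrite negbK.
have := Tk; rewrite leq_eqVlt => /orP[/eqP Tk1|Tk1]; last first.
  apply: (generic 1 [set b0]) => //; last by lia.
    by rewrite tw.
  by rewrite cards1.
apply: (@sum_matched_le _ _ _ _ 1).
- move=> F; rewrite -(cards1 b0).
  apply: (card_matched_colors F S0 C0 indep unif); first by rewrite tw.
  by rewrite cards1; lia.
- by lia.
(* For k = t the connected lift gives m D^(2(k-1)), and each D^2 absorbs one of the k-1 factors C
   left. *)
have hom := card_hom_lift_connected simpH connH aE exy (Gamma_eq2 G2 (esym Tk1))
  tw degD.
apply: (@leq_trans (#|arc_set e| * (D ^ 2 * C) ^ (k - 1))).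
  rewrite expnMn mulnA -expnM.
  have -> : (k * 2 - #|T| - 1 = k - 1)%N by lia.
  have -> : (2 * (k - 1) = #|T| * 2 - 2)%N by lia.
  by rewrite leq_mul2r hom orbT.
have -> : (#|arc_set e| ^ k = #|arc_set e| * #|arc_set e| ^ (k - 1))%N.
  by rewrite -expnS; congr expn; lia.
rewrite -[leqLHS]mul1n leq_mul ?expn_gt0 //.
rewrite leq_mul2l; apply/orP; right.
by case: (k - 1)%N => // n; rewrite leq_exp2r.
Qed.

(** Union bound over the at most 2^(2k) bit patterns that twist a vertex; each counted pair comes
    from a matched homomorphism of the corresponding lift. *)
Lemma sum_card_counted_le (R : realType) (S T V : finType) (C k : nat)
    (h : S -> V -> 'I_C) (eH : rel T) (e : rel V) (a : k.-tuple (T * T))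
    (D : nat) :
  simple_graph eH -> connected_graph eH -> no_leaves eH -> orientation eH a ->
  symmetric e -> (0 < #|S|)%N -> (0 < C)%N ->
  wise_independent R (4 * k) h -> uniform_values R h ->
  (forall u, degree e u <= D)%N ->
  (D ^ 2 * C <= #|arc_set e|)%N -> (C ^ 3 <= #|arc_set e|)%N ->
  ((\sum_z #|counted_tuples e a (h z)|) * C ^ (k * 2 - #|T|)
     <= 2 ^ (k * 2) * 2 ^ #|T| * #|arc_set e| ^ k * #|S|)%N.
Proof.
move=> simpH connH leafH aE Gsym S0 C0 indep unif degD DC C3.
pose X s z := [set F in hom_set (lift_rel a s) e
                | matched_colors (twisted a s) F (h z)].
apply: (@leq_trans (\sum_(s | twisted a s != set0)
          ((\sum_z #|X s z|) * C ^ (k * 2 - #|T|)))).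
  rewrite -big_distrl /= leq_mul2r exchange_big /=; apply/orP; right.
  apply: leq_sum => z _.
  pose f s F := (track a F s, track a F (fun i => ~~ s i)) :
     k.-tuple (V * V) * k.-tuple (V * V).
  apply: (@leq_trans #|\bigcup_(s : {ffun 'I_k * bool -> bool} |
                               twisted a s != set0) (f s @: X s z)|).
    apply/subset_leq_card/subsetP => vw /(counted_tupleP Gsym).
    case=> F [s [-> FH tw FM]]; apply/bigcupP; exists s => //.
    by apply/imsetP; exists F; rewrite // inE FH.
  apply: leq_trans (card_bigcup_le _ _) _.
  by apply: leq_sum => s _; exact: leq_imset_card.
apply: (@leq_trans (\sum_(s : {ffun 'I_k * bool -> bool} | twisted a s != set0)
                      2 ^ #|T| * #|arc_set e| ^ k * #|S|)).
  apply: leq_sum => s tw.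
  exact: sum_matched_lift_le simpH connH leafH aE S0 C0 indep unif degD
    DC C3 tw.
rewrite sum_nat_cond_const -!mulnA leq_mul2r; apply/orP; right.
apply: leq_trans (max_card _) _.
by rewrite card_ffun card_bool card_prod card_ord card_bool.
Qed.

Theorem theorem3p13 (R : realType) (t : nat) (eH : rel 'I_t) (k : nat)
    (H_simple : simple_graph eH) (H_connected : connected_graph eH)
    (H_no_leaves : no_leaves eH) (H_edges : k = #|edge_set eH|) :
  exists K : R,
    forall (a : k.-tuple ('I_t * 'I_t)) (V : finType) (eG : rel V)
      (C : nat) (S : finType) (h : S -> V -> 'I_C) (m : nat) (alpha : R),
    orientation eH a ->
    simple_graph eG ->
    m = #|arc_set eG| ->
    (0 < #|S|)%N ->
    wise_independent R (4 * k) h ->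
    uniform_values R h ->
    0 < alpha ->
    (max_degree eG)%:R <= m%:R `^ (1 / 2%:R - alpha) ->
    (t <= C)%N ->
    C%:R <= Num.min (m%:R `^ (2%:R * alpha)) (m%:R `^ (1 / 3%:R)) ->
    expectation (fun s : S => #|counted_tuples eG a (h s)|%:R)
      <= K * (m%:R ^+ k / C%:R ^ ((2 * k)%:Z - t%:Z)).
Proof.
(* 2^(2k) bounds the number of bit patterns; 2^t absorbs the choices between straight and crossed
   arcs. *)
exists (2 ^ (k * 2) * 2 ^ t)%:R.
move=> a V eG C S h m alpha aE simpG -> S0 indep unif _ Dm tC Cm.
have C0 : (0 < C)%N.
  by move: H_connected => [+ _]; rewrite card_ord => /leq_trans ->.
have CR : 0 < C%:R :> R by rewrite ltr0n.
have SR : 0 < #|S|%:R :> R by rewrite ltr0n.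
rewrite /expectation -natr_sum ler_pdivrMr //.
(* For k = 0 there are no positions, so no vertex is twisted and nothing is counted; this case is
   split off because t <= k fails in it. *)
have [k0|kpos] := posnP k.
  rewrite big1 => [|z _]; first by
    rewrite !mulr_ge0 ?invr_ge0 ?exprz_ge0 ?exprn_ge0.
  apply/eqP; rewrite cards_eq0; apply/negPn/negP => /set0Pn[vw].
  case/(counted_tupleP simpG.1) => F [s [_ _ /set0Pn[b + _]]].
  rewrite inE => /exists_inP[i _ _].
  by have := leq_ltn_trans (leq0n i.1) (ltn_ord i.1); rewrite {1}k0.
have Tk := card_le_edges (fun b => Gamma_gt1 (Ordinal kpos, false) b
  H_simple H_connected H_no_leaves aE).
have [DC C3] := sqr_degree_le C0 Dm Cm.
have degD u : (degree eG u <= max_degree eG)%N by exact: leq_bigmax.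
have := sum_card_counted_le H_simple H_connected H_no_leaves aE simpG.1 S0 C0
  indep unif degD DC C3.
rewrite card_ord in Tk *.
rewrite -(ler_nat R) 3!natrM !natrX => le.
have -> : (2 * k)%:Z - t%:Z = (k * 2 - t)%:Z by lia.
by rewrite -exprnP mulrA mulrAC ler_pdivlMr ?exprn_gt0.
Qed.
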